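(* Let $\mathcal R$ be a linear operator on polynomials with $\mathcal R Q_n=\nu_{n+1}P_{n+1}$, $n\ge0$, for some nonzero numbers $\nu_1,\nu_2,\dots$. Assume there exists a nondegenerate linear functional $\tau$ such that $$\langle \tau, g(x)\,\mathcal D f(x)\rangle = \langle \sigma, f(x)\,\mathcal R g(x)\rangle$$ for every pair of polynomials $f(x),g(x)$. Then the polynomials $Q_n(x)$ are orthogonal with respect to $\tau$, i.e. $\langle\tau,Q_nQ_m\rangle=\tilde h_n\delta_{nm}$ with $\tilde h_n\ne0$, and the operator $\mathcal R$ is uniquely determined by this relation (for the given $\sigma$, $\tau$, $\mathcal D$).
   Context: All polynomials have complex coefficients. A linear functional on polynomials is nondegenerate if all Hankel determinants $\det|m_{i+k}|_{i,k=0}^{n-1}$, $n\ge1$, of its moments $m_n$ are nonzero. $\sigma$ is a nondegenerate linear functional with moments $g_n=\langle\sigma,x^n\rangle$, $g_0=1$. $P_n(x)=x^n+O(x^{n-1})$ are the monic orthogonal polynomials: $\langle\sigma,P_nP_m\rangle=h_n\delta_{nm}$ with all $h_n\ne0$. A generalized derivative operator $\mathcal D$ is the linear operator on polynomials with $\mathcal D x^n=\mu_n x^{n-1}$, where $\mu_n$ are complex numbers with $\mu_0=0$ and $\mu_n\neq0$ for $n\ge1$. The derived monic polynomials are $Q_n(x)=\mu_{n+1}^{-1}\mathcal D P_{n+1}(x)$, $n\ge 0$. *)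

(* Defs.v *)
From HB Require Import structures.
From mathcomp Require Import all_boot all_order all_algebra.
From mathcomp Require Import reals complex.

Set Implicit Arguments.
Unset Strict Implicit.
Unset Printing Implicit Defensive.

Import GRing.Theory.

Local Open Scope ring_scope.

Definition moment (F : fieldType) (L : {scalar {poly F}}) (n : nat) : F :=
  L 'X^n.

Definition hankel (F : fieldType) (L : {scalar {poly F}}) (n : nat) : 'M[F]_n :=
  \matrix_(i < n, k < n) moment L (i + k).

Definition nondegenerate_functional (F : fieldType)
    (L : {scalar {poly F}}) : Prop :=
  forall n, (0 < n)%N -> \det (hankel L n) != 0.

Definition orthogonal_seq (F : fieldType) (L : {scalar {poly F}})
    (P : nat -> {poly F}) : Prop :=
  exists h : nat -> F, (forall n, h n != 0) /\
    forall n m, L (P n * P m) = if n == m then h n else 0.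

(* size p = n.+1 means that p has degree n. *)
Definition monic_orthogonal_polys (F : fieldType) (L : {scalar {poly F}})
    (P : nat -> {poly F}) : Prop :=
  (forall n, P n \is monic /\ size (P n) = n.+1) /\ orthogonal_seq L P.

(* For n = 0 the truncated n.-1 is harmless: the coefficient mu 0 vanishes. *)
Definition generalized_derivative (F : fieldType) (mu : nat -> F)
    (D : {linear {poly F} -> {poly F}}) : Prop :=
  [/\ mu 0%N = 0, (forall n, (0 < n)%N -> mu n != 0)
    & forall n, D 'X^n = mu n *: 'X^(n.-1)].

Definition derived_polys (F : fieldType) (mu : nat -> F)
    (D : {linear {poly F} -> {poly F}}) (P : nat -> {poly F}) (n : nat) :
    {poly F} :=
  (mu n.+1)^-1 *: D (P n.+1).

Definition adjoint_relation (F : fieldType) (sigma tau : {scalar {poly F}})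
    (D R : {linear {poly F} -> {poly F}}) : Prop :=
  forall f g : {poly F}, tau (g * D f) = sigma (f * R g).

(* Main.v *)
Require Import Defs.
From mathcomp Require Import all_boot all_order all_algebra.
From mathcomp Require Import reals complex.

Set Implicit Arguments.
Unset Strict Implicit.
Unset Printing Implicit Defensive.

Import GRing.Theory.

Local Open Scope ring_scope.

(** The adjoint relation turns both claims into statements about [sigma].
    Taking [f] to be a multiple of [P m.+1] and [g] the [n]-th derived
    polynomial, it carries the Gram matrix of the derived polynomials for [tau]
    to that of [P 1], [P 2], ... for [sigma], up to nonzero factors; the latter
    is diagonal and its entries do not vanish.  For uniqueness, two operators
    adjoint to [D] differ on each [g] by a polynomial that [sigma] annihilates
    after multiplication by any [f], and the bilinear form of a functional with
    nonzero Hankel determinants has a trivial kernel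
    ([nondegenerate_functional_inj]). *)

(** Turns annihilation of [p] by the functional into a linear system on the
    coefficients of [p]; the order [size p] makes the system square, so that
    its determinant is one of the Hankel determinants. *)
Lemma coef_mul_hankel (F : fieldType) (L : {scalar {poly F}}) (p : {poly F}) :
  (\row_(i < size p) p`_i) *m hankel L (size p) =
    \row_(k < size p) L ('X^k * p).
Proof.
apply/rowP=> k; rewrite !mxE.
transitivity (L ('X^k * \poly_(i < size p) p`_i)); last by rewrite coefK.
rewrite poly_def mulr_sumr linear_sum; apply: eq_bigr => i _.
by rewrite !mxE /moment -scalerAr linearZ /= -exprD addnC.
Qed.

Lemma nondegenerate_functional_inj (F : fieldType) (L : {scalar {poly F}})
    (p : {poly F}) :
  nondegenerate_functional L -> (forall f, L (f * p) = 0) -> p = 0.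
Proof.
move=> L_nondeg Lp0; have [-> // | p_neq0] := eqVneq p 0.
have hankel_unit : hankel L (size p) \in unitmx.
  by rewrite unitmxE unitfE L_nondeg // size_poly_gt0.
have coefs0 : \row_(i < size p) p`_i = 0 :> 'rV_(size p).
  apply: (can_inj (mulmxK hankel_unit)); rewrite mul0mx coef_mul_hankel.
  by apply/rowP=> k; rewrite !mxE Lp0.
apply/polyP=> i; rewrite coef0.
have [le_pi | lt_ip] := leqP (size p) i; first by rewrite nth_default.
by have /rowP/(_ (Ordinal lt_ip)) := coefs0; rewrite !mxE.
Qed.

Lemma adjoint_relation_uniq (F : fieldType) (sigma tau : {scalar {poly F}})
    (D R R' : {linear {poly F} -> {poly F}}) :
  nondegenerate_functional sigma -> adjoint_relation sigma tau D R ->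
  adjoint_relation sigma tau D R' -> R' =1 R.
Proof.
move=> sigma_nondeg adjR adjR' g; apply/eqP; rewrite -subr_eq0; apply/eqP.
apply: (nondegenerate_functional_inj sigma_nondeg) => f.
by rewrite mulrBr linearB /= -adjR -adjR' subrr.
Qed.

(** The [D] hidden in the second factor is moved onto the first factor as [R],
    which raises it to a multiple of [P n.+1]. *)
Lemma derived_polys_gram (F : fieldType) (sigma tau : {scalar {poly F}})
    (D R : {linear {poly F} -> {poly F}}) (mu nu : nat -> F)
    (P : nat -> {poly F}) :
  adjoint_relation sigma tau D R ->
  (forall n, R (derived_polys mu D P n) = nu n.+1 *: P n.+1) ->
  forall n m, tau (derived_polys mu D P n * derived_polys mu D P m) =
    (mu m.+1)^-1 * nu n.+1 * sigma (P m.+1 * P n.+1).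
Proof.
move=> adjR raising n m; rewrite {2}/derived_polys -scalerAr linearZ /= adjR.
by rewrite raising -scalerAr linearZ /= mulrA.
Qed.

Theorem proposition2 (K : realType)
    (sigma : {scalar {poly K[i]}})
    (sigma_nondeg : nondegenerate_functional sigma)
    (sigma_normalized : moment sigma 0 = 1)
    (P : nat -> {poly K[i]})
    (P_orth : monic_orthogonal_polys sigma P)
    (mu : nat -> K[i])
    (D : {linear {poly K[i]} -> {poly K[i]}})
    (D_deriv : generalized_derivative mu D)
    (R : {linear {poly K[i]} -> {poly K[i]}})
    (nu : nat -> K[i])
    (nu_neq0 : forall n, nu n.+1 != 0)
    (R_raising : forall n, R (derived_polys mu D P n) = nu n.+1 *: P n.+1)
    (tau : {scalar {poly K[i]}})
    (tau_nondeg : nondegenerate_functional tau)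
    (R_adjoint : adjoint_relation sigma tau D R) :
  orthogonal_seq tau (derived_polys mu D P) /\
  (forall R' : {linear {poly K[i]} -> {poly K[i]}},
     adjoint_relation sigma tau D R' -> forall g, R' g = R g).
Proof.
split; last by move=> R'; apply: adjoint_relation_uniq R_adjoint.
have [_ [h [h_neq0 Ph]]] := P_orth; have [_ mu_neq0 _] := D_deriv.
exists (fun n => (mu n.+1)^-1 * nu n.+1 * h n.+1); split=> [n | n m].
  by rewrite !mulf_neq0 ?invr_eq0 ?mu_neq0.
rewrite (derived_polys_gram R_adjoint R_raising) Ph eqSS eq_sym.
by case: eqP => [-> | _]; rewrite ?mulr0.
Qed.
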